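(* Consider an uncertain Markov decision process with finite horizon $T$ in which the parameters $(p_t,r_t)$ realized at decision stage $t$ are random, $t=1,\dots,T$. Suppose the parameters of different stages deviate independently, with probability $\alpha_t$ for $t=1,\dots,T$; that is, the events $\{(p_t,r_t)\neq(p_t^0,r_t^0)\}$, $t=1,\dots,T$, are mutually independent and the $t$-th has probability $\alpha_t$. Let $\delta\in(0,1)$. Then with probability at least $1-\delta$ the total number of deviations satisfies $$\sum_{t=1}^{T}\mathbf{1}_{(p_t,r_t)\neq(p_t^0,r_t^0)}\ \le\ \sum_{t=1}^{T}\alpha_t+\frac13\log(1/\delta)\left(1+\sqrt{1+18\,\frac{\sum_{t=1}^{T}\alpha_t}{\log(1/\delta)}}\right).$$
   Context: The MDP has finite state space $\mathcal{S}$ and finite action space $\mathcal{A}$. For each state $s$, $(p_s^0,r_s^0)$ are the nominal transition probabilities and rewards of $s$, belonging to a convex uncertainty set $\mathcal{U}_s$. At decision stage $t$ the system is in a (random) state $s_t$; $(p_t,r_t)\in\mathcal{U}_{s_t}$ denotes the parameters of state $s_t$ realized at stage $t$ (they may differ between visits to the same state), and $(p_t^0,r_t^0)=(p_{s_t}^0,r_{s_t}^0)$ the nominal ones. The parameters deviate at stage $t$ if $(p_t,r_t)\neq(p_t^0,r_t^0)$. $\log$ is the natural logarithm. *)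

(* Defs.v *)
From HB Require Import structures.
From mathcomp Require Import all_boot all_order all_algebra.
From mathcomp Require Import all_classical all_reals all_analysis.

Set Implicit Arguments.
Unset Strict Implicit.
Unset Printing Implicit Defensive.

Import Order.TTheory GRing.Theory Num.Theory.
Import numFieldNormedType.Exports.

Local Open Scope classical_set_scope.
Local Open Scope ring_scope.

(* The parameters (p, r) of one state: [x.1 a s'] is the probability of moving
   to [s'] under action [a], and [x.2 a] is the reward of [a]. The codomain is
   [R^o], the line as a module over itself, so that the type carries the vector
   space structure that [convex_set] requires. *)
Definition parameter (R : realType) (S A : finType) : Type :=
  ((A -> S -> R^o) * (A -> R^o))%type.

Definition transition_probability (R : realType) (S A : finType)
    (p : A -> S -> R) : Prop :=
  forall a, (forall s', 0 <= p a s') /\ \sum_s' p a s' = 1.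

Record uncertain_mdp (R : realType) (S A : finType) := UncertainMDP {
  nominal : S -> parameter R S A;
  uncertainty : S -> set (parameter R S A);
  uncertainty_convex : forall s,
    @convex_set R ((A -> S -> R^o) * (A -> R^o))%type (uncertainty s);
  uncertainty_transition : forall s x,
    uncertainty s x -> transition_probability x.1;
  nominal_uncertainty : forall s, uncertainty s (nominal s) }.

(* A random run over a horizon of [T] stages; the ordinal [t : 'I_T] stands for
   the stage [t + 1]. The joint law of states and parameters is arbitrary: in
   particular no law of motion ties the next state to the current parameters,
   and the parameters may differ between visits to the same state. *)
Record random_run (R : realType) (S A : finType) (M : uncertain_mdp R S A)
    (T : nat) (d : measure_display) (Omega : measurableType d) := RandomRun {
  state : 'I_T -> Omega -> S;
  realized : 'I_T -> Omega -> parameter R S A;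
  state_measurable : forall t s, measurable (state t @^-1` [set s]);
  transition_measurable : forall t a s',
    measurable_fun [set: Omega] (fun w => (realized t w).1 a s' : R);
  reward_measurable : forall t a,
    measurable_fun [set: Omega] (fun w => (realized t w).2 a : R);
  realized_uncertainty : forall t w, uncertainty M (state t w) (realized t w) }.

Definition deviation (R : realType) (S A : finType) (M : uncertain_mdp R S A)
    (T : nat) (d : measure_display) (Omega : measurableType d)
    (X : random_run M T Omega) (t : 'I_T) : set Omega :=
  [set w | realized X t w <> nominal M (state X t w)].

Definition mutually_independent (R : realType) (d : measure_display)
    (Omega : measurableType d) (P : probability Omega R) (I : finType)
    (E : I -> set Omega) : Prop :=
  forall J : {set I},
    P (\bigcap_(i in [set` J]) E i) = (\prod_(i in J) P (E i))%E.

(* Main.v *)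
(* Bernstein's inequality by the Chernoff method. Let N be the number of
   deviations, s the sum of the alpha_t, and t >= 0. Expanding
   exp (t N) = \prod_i (1 + (exp t - 1) 1_(E i)) over subsets of stages and using
   independence gives E exp (t N) <= exp (s (exp t - 1)), hence
   P (N > s + x) <= exp (s (exp t - 1 - t) - t x). The choice
   t = x / (s + x / 3) bounds this by exp (- x^2 / (2 (s + x / 3))), and the
   radius x of the theorem is the positive root of
   x^2 = 2 (s + x / 3) ln (1 / delta). *)
Require Import Defs.
From mathcomp Require Import all_boot all_order all_algebra.
From mathcomp Require Import all_classical all_reals all_analysis.
From mathcomp Require Import measurable_realfun ring lra.

Set Implicit Arguments.
Unset Strict Implicit.
Unset Printing Implicit Defensive.

Import Order.TTheory GRing.Theory Num.Theory.
Import numFieldNormedType.Exports.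

Local Open Scope classical_set_scope.
Local Open Scope ring_scope.

Lemma ge0_is_derive_ge (R : realType) (f df : R -> R) :
  (forall x : R, is_derive x 1 f (df x)) -> (forall x, 0 <= x -> 0 <= df x) ->
  forall x, 0 <= x -> f 0 <= f x.
Proof.
move=> fdf df0 x x0; apply: (@ger0_derive1_ndecry _ f 0) => //.
- move=> y; rewrite in_itv/= andbT => y0.
  by rewrite derive1E (@derive_val _ _ _ _ _ _ _ (fdf y)); exact/df0/ltW.
- apply: continuous_subspaceT => y.
  have dfy := @ex_derive _ _ _ _ _ _ _ (fdf y).
  exact/differentiable_continuous/derivable1_diffP.
Qed.

(* Multiplied by [1 - x / 3] rather than divided by it, the bound also holds for
   [3 <= x], so that [\sum_i a i = 0], where [t = 3], needs no separate case. *)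
Lemma bernstein_expR (R : realType) (x : R) : 0 <= x ->
  (1 - x / 3) * (expR x - 1 - x) <= x ^+ 2 / 2.
Proof.
move=> x0.
(* [f] is the right side minus the left, expanded, and [g] is its derivative. Both vanish at [0], so
   monotonicity, applied twice, reduces the claim to [0 <= g'], that is, to
   [1 - y <= expR (- y)]. *)
pose f := fun y : R => 1 + 2 / 3 * y + 6^-1 * y ^+ 2 - (1 - 3^-1 * y) * expR y.
pose g := fun y : R => 2 / 3 + 3^-1 * y - (2 / 3 - 3^-1 * y) * expR y.
have dg (y : R) : is_derive y 1 g (3^-1 * (1 - (1 - y) * expR y)).
  apply: is_derive_eq; rewrite /GRing.scale/=; by field.
have g0 y : 0 <= y -> 0 <= g y.
  move=> y0; suff : g 0 <= g y by rewrite {1}/g expR0; lra.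
  apply: (ge0_is_derive_ge dg) => // z _; rewrite mulr_ge0// subr_ge0.
  rewrite -ler_pdivlMr ?expR_gt0// div1r -expRN.
  exact: expR_ge1Dx.
have df (y : R) : is_derive y 1 f (g y).
  apply: is_derive_eq; rewrite /GRing.scale/= /g; by field.
have := ge0_is_derive_ge df g0 x0.
by rewrite /f expR0; lra.
Qed.

(** Measurability is given only for the state and for each coordinate of the parameters. Since
    states and actions are finite, the complement is a finite union, over the current state [s], of
    finite intersections of coordinate equalities with the nominal values of [s]. *)
Lemma measurable_deviation (R : realType) (S A : finType)
    (M : uncertain_mdp R S A) (T : nat) (d : measure_display)
    (Omega : measurableType d) (X : random_run M T Omega) (t : 'I_T) :
  measurable (deviation X t).
Proof.
pose F s := state X t @^-1` [set s] `&`
  (\bigcap_(i in [set: A * S])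
     [set w | (realized X t w).1 i.1 i.2 = (nominal M s).1 i.1 i.2] `&`
   \bigcap_(a in [set: A]) [set w | (realized X t w).2 a = (nominal M s).2 a]).
have -> : deviation X t = ~` \bigcup_(s in [set: S]) F s.
  rewrite /deviation; apply/seteqP; split => w /= h.
    move=> [s _ [/= <- [h1 h2]]]; apply: h.
    rewrite [LHS]surjective_pairing [RHS]surjective_pairing; congr pair.
      by apply/funext => a; apply/funext => s'; exact: (h1 (a, s')).
    by apply/funext => a; exact: h2.
  by move=> e; apply: h; exists (state X t w) => //; split=> //; split=> i _ /=; rewrite e.
apply: measurableC; apply: fin_bigcup_measurable => // s _.
have eqm (f : Omega -> R) (r : R) : measurable_fun [set: Omega] f ->
    measurable [set w | f w = r].
  move=> mf; rewrite -[X in measurable X]setTI.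
  exact: (mf measurableT [set r] (measurable_set1 r)).
apply: measurableI; first exact: state_measurable.
apply: measurableI; apply: fin_bigcap_measurable => // i _; apply: eqm.
  exact: transition_measurable.
exact: reward_measurable.
Qed.

Section bernoulli_sum.
Context (R : realType) (d : measure_display) (Omega : measurableType d)
  (P : probability Omega R) (I : finType) (E : I -> set Omega) (a : I -> R).
Hypothesis mE : forall i, measurable (E i).
Hypothesis indepE : mutually_independent P E.
Hypothesis PE : forall i, P (E i) = (a i)%:E.

Lemma prod_indic (J : {set I}) w :
  \prod_(i in J) (\1_(E i) w : R) = \1_(\bigcap_(i in [set` J]) E i) w.
Proof.
have [Jw|/existsNP[i /not_implyP[iJ Ew]]] :=
    pselect (forall i, i \in J -> E i w).
  rewrite big1 => [|i iJ]; first by rewrite indicE mem_set.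
  by rewrite indicE mem_set//; exact: Jw.
rewrite (bigD1 i)//= indicE memNset// mul0r indicE memNset// => Jw.
by apply: Ew; exact: Jw.
Qed.

Lemma measurable_bigcap_event (J : {set I}) :
  measurable (\bigcap_(i in [set` J]) E i).
Proof. by apply: fin_bigcap_measurable => // i _; exact: mE. Qed.

Lemma prod_1D (c : R) (f : I -> R) :
  \prod_i (1 + c * f i) = \sum_(J : {set I}) c ^+ #|J| * \prod_(i in J) f i.
Proof.
under eq_bigr do rewrite addrC.
rewrite bigA_distr; apply: eq_bigr => J _.
by rewrite -big_mkcond big_split/= prodr_const.
Qed.

(** After expansion over subsets, each term is a multiple of the indicator of an intersection of
    events [E i], so the product rule of [indepE] applies to it directly. The sign of [c] makes the
    terms nonnegative, which lets sum and integral commute. *)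
Lemma integral_prod_indic (c : R) : 0 <= c ->
  (\int[P]_w (\prod_i (1 + c * \1_(E i) w))%:E = (\prod_i (1 + c * a i))%:E)%E.
Proof.
move=> c0.
under eq_integral do rewrite prod_1D -sumEFin.
rewrite ge0_integral_sum//; last 2 first.
- move=> J; apply/measurable_EFinP; apply: measurable_funM => //.
  under eq_fun do rewrite prod_indic.
  exact/measurable_indic/measurable_bigcap_event.
- by move=> J w _; rewrite lee_fin mulr_ge0 ?exprn_ge0// prodr_ge0.
rewrite prod_1D -sumEFin; apply: eq_bigr => J _.
under eq_integral do rewrite prod_indic EFinM.
rewrite ge0_integralZl_EFin ?exprn_ge0//; last first.
  exact/measurable_EFinP/measurable_indic/measurable_bigcap_event.
rewrite integral_indic//; last exact: measurable_bigcap_event.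
rewrite setIT EFinM; congr (_ * _)%E.
by rewrite -prodEFin -(eq_bigr _ (fun i _ => PE i)); exact: indepE.
Qed.

Lemma bernoulli_chernoff (b t : R) : 0 <= t ->
  (P [set w | (b < \sum_i (\1_(E i) w : R))%R] <=
   (expR ((\sum_i a i) * (expR t - 1) - t * b)%R)%:E)%E.
Proof.
move=> t0; set B := [set w | _].
have mN : measurable_fun [set: Omega] (fun w => \sum_i (\1_(E i) w : R)).
  by apply: measurable_sum => i; exact: measurable_indic.
have mB : measurable B.
  by rewrite -[B]setTI; exact: (measurable_fun_ltr _ mN).
have c0 : 0 <= expR t - 1 by rewrite subr_ge0 -expR0 ler_expR.
have expN w : expR (t * \sum_i (\1_(E i) w : R)) =
    \prod_i (1 + (expR t - 1) * \1_(E i) w).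
  rewrite mulr_sumr expR_sum; apply: eq_bigr => i _.
  rewrite indicE; case: (_ \in _); rewrite ?mulr1 ?mulr0 ?expR0 ?addr0//.
  by rewrite addrC subrK.
(* Markov's inequality: [expR (t * b) * \1_B] lies pointwise below the exponential of [t] times the
   sum of indicators. *)
have : ((expR (t * b))%:E * P B <= (\prod_i (1 + (expR t - 1) * a i))%:E)%E.
  rewrite -integral_prod_indic// -[B]setIT -integral_indic//.
  rewrite -ge0_integralZl_EFin ?expR_ge0//; last first.
    exact/measurable_EFinP/measurable_indic.
  apply: ge0_le_integral => //.
  - by apply/measurable_EFinP/measurable_funM => //; exact: measurable_indic.
  - apply/measurable_EFinP; under eq_fun do rewrite -expN.
    by apply: measurableT_comp => //; exact: measurable_funM.
  move=> w _; rewrite -EFinM lee_fin -expN indicE.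
  case: (boolP (w \in B)) => [|_]; last by rewrite mulr0 expR_ge0.
  by rewrite inE /B/= mulr1 ler_expR => /ltW; exact: ler_wpM2l.
rewrite -(fineK (fin_num_measure P B mB)) -EFinM !lee_fin => h.
rewrite expRD expRN ler_pdivlMr ?expR_gt0// mulrC.
(* Factor by factor, [1 + u <= expR u] with [u = a i * (expR t - 1)]. *)
apply: (le_trans h); rewrite mulr_suml expR_sum; apply: ler_prod => i _.
have a0 : 0 <= a i by rewrite -lee_fin -PE.
by rewrite addr_ge0 ?mulr_ge0//= [a i * _]mulrC expR_ge1Dx.
Qed.

Lemma bernoulli_bernstein (x : R) : 0 < x ->
  (P [set w | (\sum_i a i + x < \sum_i (\1_(E i) w : R))%R] <=
   (expR (- (x ^+ 2 / (2 * (\sum_i a i + x / 3))))%R)%:E)%E.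
Proof.
move=> x0; set s := \sum_i a i.
have s0 : 0 <= s by apply: sumr_ge0 => i _; rewrite -lee_fin -PE.
have v0 : 0 < s + x / 3 by lra.
pose t := x / (s + x / 3).
have t0 : 0 <= t by rewrite divr_ge0// ltW.
apply: (le_trans (bernoulli_chernoff _ t0)).
rewrite lee_fin ler_expR -/s.
(* The choice of [t] gives [(s + x / 3) * (1 - t / 3) = s], so scaling by [s + x / 3] yields
   [s * (expR t - 1 - t) <= t * x / 2]. The Chernoff exponent is [s * (expR t - 1 - t) - t * x],
   hence at most [- (t * x / 2)]. *)
have := bernstein_expR t0; rewrite -(ler_pM2l v0).
have -> : (s + x / 3) * ((1 - t / 3) * (expR t - 1 - t)) = s * (expR t - 1 - t).
  by rewrite mulrA; congr (_ * _); rewrite /t; field; apply/lt0r_neq0; lra.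
have -> : (s + x / 3) * (t ^+ 2 / 2) = t * x / 2.
  by rewrite /t; field; apply/lt0r_neq0; lra.
have -> : x ^+ 2 / (2 * (s + x / 3)) = t * x / 2.
  by rewrite /t; field; apply/lt0r_neq0; lra.
lra.
Qed.

End bernoulli_sum.

Lemma bernstein_radiusE (R : realType) (s L : R) : 0 <= s -> 0 < L ->
  let x := 3^-1 * L * (1 + Num.sqrt (1 + 18 * (s / L))) in
  x ^+ 2 / (2 * (s + x / 3)) = L.
Proof.
move=> s0 L0; set q := Num.sqrt _ => x.
have q0 : 0 <= q by exact: sqrtr_ge0.
(* Writing [s] in terms of the root [q] removes the radical: the claim becomes rational in [q], and
   [s + x / 3] a multiple of the square of [1 + q]. *)
have sE : s = L * (q ^+ 2 - 1) / 18.
  rewrite sqr_sqrtr ?addr_ge0 ?mulr_ge0 ?invr_ge0 ?(ltW L0)//.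
  by field; exact: lt0r_neq0.
rewrite /x; clearbody q; subst s.
have -> : L * (q ^+ 2 - 1) / 18 + 3^-1 * L * (1 + q) / 3 =
  L * (1 + q) ^+ 2 / 18 by field.
by field; rewrite !lt0r_neq0 ?ltr_pwDl.
Qed.

Theorem theorem4 (R : realType) (S A : finType) (M : uncertain_mdp R S A)
    (T : nat) (d : measure_display) (Omega : measurableType d)
    (P : probability Omega R) (X : random_run M T Omega)
    (alpha : 'I_T -> R)
    (indep : mutually_independent P (deviation X))
    (prob_dev : forall t, P (deviation X t) = (alpha t)%:E)
    (delta : R) (delta_gt0 : 0 < delta) (delta_lt1 : delta < 1) :
  ((1 - delta)%:E <=
   P [set w | (\sum_(t < T) (\1_(deviation X t) w : R) <=
        \sum_(t < T) alpha t +
        3^-1 * ln (1 / delta) *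
        (1 + Num.sqrt (1 + 18 * ((\sum_(t < T) alpha t) / ln (1 / delta)))))%R])%E.
Proof.
have mD := measurable_deviation X.
set s := \sum_t alpha t; set L := ln (1 / delta); set x := 3^-1 * L * _.
have s0 : 0 <= s by apply: sumr_ge0 => t _; rewrite -lee_fin -prob_dev.
have L0 : 0 < L by rewrite ln_gt0// ltr_pdivlMr// mul1r.
have x0 : 0 < x.
  by rewrite /x !mulr_gt0 ?invr_gt0 ?ltr_pwDl// sqrtr_ge0.
(* At this radius the exponent is exactly [- L], so the strict upper tail has probability at most
   [expR (- L) = delta]; the event of the theorem is its complement. *)
have := bernoulli_bernstein mD indep prob_dev x0.
rewrite -/s (bernstein_radiusE s0 L0) expRN lnK ?posrE ?divr_gt0//.
rewrite div1r invrK => tail.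
set B := [set w | _] in tail *.
set C := (X in P X).
have -> : C = ~` B.
  by apply/seteqP; split => w; rewrite /C /B/= leNgt => /negP.
rewrite probability_setC; last first.
  rewrite -[B]setTI; apply: measurable_fun_ltr => //.
  by apply: measurable_sum => t; exact: measurable_indic.
by rewrite EFinB leeB.
Qed.
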